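(* Let $n \in \mathbb{N}$. Then the monoid $UT_n^{\{0\}}(\mathbb{Z}_{\max})$ is minimally and irredundantly generated by $\{I_n\} \cup E(\mathbb{Z})$, where $$E(\mathbb{Z}) = \{E_{ij}(z) : z \in \mathbb{Z},\ 1 \le i < j \le n\}.$$
   Context: $\mathbb{N}$ is the set of positive integers. $\mathbb{Z}_{\max} = \mathbb{Z}\cup\{-\infty\}$ is the tropical integer semiring, with semiring addition $\max$ and semiring multiplication the usual addition; its semiring zero is $-\infty$ and its semiring one is $0$. $UT_n^{\{0\}}(\mathbb{Z}_{\max})$ is the monoid, under (tropical) matrix multiplication, of $n\times n$ unitriangular matrices over $\mathbb{Z}_{\max}$: all entries below the diagonal are $-\infty$ and all diagonal entries are $0$. $I_n$ is the identity matrix ($0$ on the diagonal, $-\infty$ elsewhere). For $i<j$, $E_{ij}(z)$ is the $n\times n$ matrix with diagonal entries $0$, $(i,j)$ entry $z$, and all other entries $-\infty$. A subset $X$ of a semigroup $\mathcal{S}$ is a generating set if $\mathcal{S}$ is the smallest subsemigroup containing $X$. It is minimal if $|X|\le |Y|$ for every generating set $Y$ of $\mathcal{S}$, and irredundant if for each $x\in X$, $X \setminus\{x\}$ is not a generating set. ''Minimally and irredundantly generated by $X$'' means $X$ is a minimal and irredundant generating set. *)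

(* Defs.v *)
From HB Require Import structures.
From mathcomp Require Import all_boot all_order all_algebra.
From mathcomp Require Import boolp classical_sets functions cardinality.

Set Implicit Arguments.
Unset Strict Implicit.
Unset Printing Implicit Defensive.

Import Order.TTheory GRing.Theory Num.Theory.
Local Open Scope classical_set_scope.
Local Open Scope ring_scope.

(* [Some z] is the integer z and [None] is minus infinity.  The semiring
   structure below makes [0 : Zmax] minus infinity, [1 : Zmax] the integer 0,
   [+] the maximum and [*] the usual addition, so that [*m] is tropical matrix
   multiplication and [1%:M] the tropical identity matrix. *)
Definition Zmax : Type := option int.
HB.instance Definition _ := Choice.on Zmax.

Definition Zmax_add (x y : Zmax) : Zmax :=
  match x, y with
  | Some a, Some b => Some (Num.max a b)
  | None, _ => y
  | _, None => x
  end.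

Definition Zmax_mul (x y : Zmax) : Zmax :=
  match x, y with
  | Some a, Some b => Some (a + b)
  | _, _ => None
  end.

Lemma Zmax_addA : associative Zmax_add.
Proof. by move=> [a|] [b|] [c|] //=; rewrite maxA. Qed.

Lemma Zmax_addC : commutative Zmax_add.
Proof. by move=> [a|] [b|] //=; rewrite maxC. Qed.

Lemma Zmax_add0 : left_id (None : Zmax) Zmax_add.
Proof. by case. Qed.

Lemma Zmax_mulA : associative Zmax_mul.
Proof. by move=> [a|] [b|] [c|] //=; rewrite addrA. Qed.

Lemma Zmax_mulC : commutative Zmax_mul.
Proof. by move=> [a|] [b|] //=; rewrite addrC. Qed.

Lemma Zmax_mul1 : left_id (Some 0 : Zmax) Zmax_mul.
Proof. by case=> //= a; rewrite add0r. Qed.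

Lemma Zmax_mulDl : left_distributive Zmax_mul Zmax_add.
Proof. by move=> [a|] [b|] [c|] //=; rewrite addr_maxl. Qed.

Lemma Zmax_mul0 : left_zero (None : Zmax) Zmax_mul.
Proof. by []. Qed.

Lemma Zmax_1neq0 : (Some 0 : Zmax) != None.
Proof. by []. Qed.

HB.instance Definition _ :=
  GRing.isNmodule.Build Zmax Zmax_addA Zmax_addC Zmax_add0.
HB.instance Definition _ :=
  GRing.Nmodule_isComNzSemiRing.Build Zmax
    Zmax_mulA Zmax_mulC Zmax_mul1 Zmax_mulDl Zmax_mul0 Zmax_1neq0.

Definition unitriangular (n : nat) : pred 'M[Zmax]_n :=
  fun M => [forall i, M i i == 1] &&
           [forall i : 'I_n, forall j : 'I_n, (j < i)%N ==> (M i j == 0)].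

Lemma unitriangularP n (M : 'M[Zmax]_n) :
  reflect ((forall i, M i i = 1) /\
           (forall i j : 'I_n, (j < i)%N -> M i j = 0))
          (unitriangular M).
Proof.
apply: (iffP andP) => -[M1 M0]; split.
- by move=> i; apply/eqP/(forallP M1).
- by move=> i j ji; apply/eqP/(implyP (forallP (forallP M0 i) j)).
- by apply/forallP => i; rewrite M1.
- by apply/forallP => i; apply/forallP => j; apply/implyP => ji; rewrite M0.
Qed.

Lemma unitriangular1 n : unitriangular (1%:M : 'M[Zmax]_n).
Proof.
apply/unitriangularP; split=> [i|i j ji]; first by rewrite mxE eqxx.
by rewrite mxE -val_eqE gtn_eqF.
Qed.

Lemma unitriangularM n (A B : 'M[Zmax]_n) :
  unitriangular A -> unitriangular B -> unitriangular (A *m B).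
Proof.
move=> /unitriangularP[A1 A0] /unitriangularP[B1 B0].
apply/unitriangularP; split=> [i|i j ji]; rewrite mxE.
  rewrite (bigD1 i) //= A1 B1 mulr1 big1 ?addr0 // => k.
  rewrite -val_eqE neq_ltn => /orP[ki|ik]; first by rewrite A0 ?mul0r.
  by rewrite B0 ?mulr0.
apply: big1 => k _; case: (ltnP k i) => [ki|ik]; first by rewrite A0 ?mul0r.
by rewrite B0 ?mulr0 // (leq_trans ji).
Qed.

Record UT (n : nat) := MkUT
  { UTval :> 'M[Zmax]_n; UT_unitriangular : unitriangular UTval }.

HB.instance Definition _ n := [isSub for @UTval n].
HB.instance Definition _ n := [Choice of UT n by <:].

Definition UT1 n : UT n := MkUT (unitriangular1 n).

Definition UTmul n (A B : UT n) : UT n :=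
  MkUT (unitriangularM (UT_unitriangular A) (UT_unitriangular B)).

Lemma UTmulA n : associative (@UTmul n).
Proof. by move=> A B C; apply: val_inj; rewrite /= mulmxA. Qed.

Lemma UTmul1 n : left_id (UT1 n) (@UTmul n).
Proof. by move=> A; apply: val_inj; rewrite /= mul1mx. Qed.

Lemma UT1mul n : right_id (UT1 n) (@UTmul n).
Proof. by move=> A; apply: val_inj; rewrite /= mulmx1. Qed.

HB.instance Definition _ n :=
  isMonoid.Build (UT n) (@UTmulA n) (@UTmul1 n) (@UT1mul n).

Definition Emx n (i j : 'I_n) (z : int) : 'M[Zmax]_n :=
  \matrix_(k, l) if k == l then 1
                 else if (k == i) && (l == j) then (Some z : Zmax) else 0.

Lemma unitriangular_Emx n (i j : 'I_n) (z : int) :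
  (i < j)%N -> unitriangular (Emx i j z).
Proof.
move=> ij; apply/unitriangularP; split=> [k|k l lk]; rewrite mxE ?eqxx //.
rewrite -val_eqE gtn_eqF //=; case: andP => // -[/eqP ki /eqP lj].
by move: lk; rewrite ki lj ltnNge (ltnW ij).
Qed.

Definition UTE n (i j : 'I_n) (ij : (i < j)%N) (z : int) : UT n :=
  MkUT (unitriangular_Emx z ij).

Definition elementaryUT n : set (UT n) :=
  [set M | exists (i j : 'I_n) (ij : (i < j)%N) (z : int), M = UTE ij z].
Arguments elementaryUT : clear implicits.

Section Generation.
Variable S : semigroupType.
Implicit Types X Y H : set S.

(* The empty set counts as a subsemigroup; hence the empty set does not
   generate the trivial monoid. *)
Definition subsemigroup H : Prop :=
  forall x y, H x -> H y -> H (x * y)%g.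

Definition generating X : Prop := smallest subsemigroup X = [set: S].

Definition minimal_generating X : Prop :=
  generating X /\ forall Y, generating Y -> (X #<= Y)%card.

Definition irredundant_generating X : Prop :=
  generating X /\ forall x, X x -> ~ generating (X `\ x).

End Generation.

(* Main.v *)
Require Import Defs.
From mathcomp Require Import all_boot all_order all_algebra.
From mathcomp Require Import boolp classical_sets functions cardinality.

(** Every off-diagonal support point of a factor survives in a product of
    tropical unitriangular matrices: the diagonal entries are the semiring one,
    and a maximum is minus infinity only if all its terms are.  Hence in a
    factorisation [A * B] of the identity both factors are the identity, and in
    one of [E_ij(z)] both factors are supported on the diagonal and [(i, j)], so
    that [z] is the maximum of [A i j] and [B i j], that is, one of the two.
    Each element of the proposed generating set therefore equals a factor of
    each of its factorisations ([factor_UT1], [factor_UTE]).  The complement of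
    such an element is a subsemigroup, so every generating set contains it
    ([generating_unavoidable]), which gives minimality and irredundancy together.

    For generation, the off-diagonal entries of a matrix are peeled off one by
    one, from the lowest nontrivial row upwards ([UTE_mul_clear]).  Taken in this
    order the elementary factors create no cross terms: the rows below the
    current one are already those of the identity. *)

Set Implicit Arguments.
Unset Strict Implicit.
Unset Printing Implicit Defensive.

Import GRing.Theory.
Local Open Scope classical_set_scope.
Local Open Scope ring_scope.

(** * Unavoidable elements of a semigroup *)

Section Unavoidable.
Variable S : semigroupType.
Implicit Types (p x y : S) (X Y : set S).

(** The hypothesis says exactly that the complement of [p] is a subsemigroup,
    and a proper subsemigroup contains no generating set. *)
Lemma generating_unavoidable p Y :
  (forall x y, (x * y)%g = p -> x = p \/ y = p) -> generating Y -> Y p.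
Proof.
move=> factor_p genY; apply: contrapT => nYp.
have : smallest (@subsemigroup S) Y p by rewrite genY.
move=> /(_ (~` [set p])); apply=> //; split.
- by move=> x y /= nx ny /factor_p[].
- by move=> x Yx /= xp; apply: nYp; rewrite -xp.
Qed.

Lemma unavoidable_minimal_irredundant X :
  generating X ->
  (forall p, X p -> forall x y, (x * y)%g = p -> x = p \/ y = p) ->
  minimal_generating X /\ irredundant_generating X.
Proof.
move=> genX factorX; split; split=> //.
- move=> Y genY; apply: subset_card_le => p Xp.
  exact: generating_unavoidable (factorX p Xp) genY.
- by move=> p Xp /(generating_unavoidable (factorX p Xp))[_]; apply.
Qed.

End Unavoidable.

(** * Tropical arithmetic *)

Lemma Zmax_add_eq0 (x y : Zmax) : x + y = 0 -> x = 0 /\ y = 0.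
Proof. by case: x y => [a|] [b|]. Qed.

Lemma Zmax_add_select (x y : Zmax) : x + y = x \/ x + y = y.
Proof.
case: x y => [a|] [b|]; [|by left|by right|by left].
rewrite /GRing.add /= /Order.max.
by case: ifP => _; [right|left].
Qed.

(** * Unitriangular matrices and their factorisations *)

Section Unitriangular.
Variable n : nat.
Implicit Types (A B M : UT n) (i j k l : 'I_n).

Lemma UT_diag M i : M i i = 1.
Proof. by case: M => M /= /unitriangularP[]. Qed.

Lemma UT_lower M i j : (j < i)%N -> M i j = 0.
Proof. by case: M => M /= /unitriangularP[_]; apply. Qed.

Lemma UTmulE A B i j : (A * B)%g i j = \sum_k A i k * B k j.
Proof. by rewrite /= mxE. Qed.

Lemma UT_eq A B : (forall i j, i != j -> A i j = B i j) -> A = B.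
Proof.
move=> AB; apply: val_inj; apply/matrixP => i j /=.
by have [<-|/AB//] := eqVneq i j; rewrite !UT_diag.
Qed.

(** The two extreme terms of the matrix product, where one factor is a
    diagonal entry. *)
Lemma UTmul_offdiag A B i j : i != j ->
  (A * B)%g i j
    = A i j + B i j + \sum_(k | (k != i) && (k != j)) A i k * B k j.
Proof.
move=> ij; rewrite UTmulE (bigD1 i) //= (bigD1 j) 1?eq_sym //=.
by rewrite !UT_diag mul1r mulr1 addrA [B i j + _]addrC.
Qed.

Lemma UTmul_eq0 A B i j : i != j -> (A * B)%g i j = 0 -> A i j = 0 /\ B i j = 0.
Proof.
by move=> ij; rewrite UTmul_offdiag // => /Zmax_add_eq0[/Zmax_add_eq0].
Qed.

Lemma factor_UT1 A B : (A * B)%g = 1%g -> A = 1%g \/ B = 1%g.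
Proof.
move=> AB1; left; apply: UT_eq => i j ij.
have I0 : (1%g : UT n) i j = 0 by rewrite /= mxE (negPf ij).
by rewrite I0; apply: (proj1 (@UTmul_eq0 A B i j ij _)); rewrite AB1.
Qed.

Lemma UTE_entry i j (ij : (i < j)%N) z : UTE ij z i j = Some z.
Proof. by rewrite /= mxE !eqxx /= -val_eqE ltn_eqF. Qed.

Lemma UTE_entry0 i j (ij : (i < j)%N) z k l :
  k != l -> ~~ ((k == i) && (l == j)) -> UTE ij z k l = 0.
Proof. by move=> kl /negPf nij; rewrite /= mxE (negPf kl) nij. Qed.

Lemma factor_UTE i j (ij : (i < j)%N) z A B :
  (A * B)%g = UTE ij z -> A = UTE ij z \/ B = UTE ij z.
Proof.
move=> ABE; have nij : i != j by rewrite -val_eqE ltn_eqF.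
have zero k l : k != l -> ~~ ((k == i) && (l == j)) -> A k l = 0 /\ B k l = 0.
  by move=> kl ne; apply: UTmul_eq0; rewrite // ABE UTE_entry0.
have zE : Some z = A i j + B i j.
  rewrite -(UTE_entry ij) -ABE UTmul_offdiag // big1 ?addr0 // => k.
  case/andP=> ki kj; have [||-> _] := @zero i k; rewrite ?mul0r //.
    by rewrite eq_sym.
  by rewrite eqxx (negPf kj).
have [zA|zB] := Zmax_add_select (A i j) (B i j); [left|right].
all: apply: UT_eq => k l kl.
all: have [/andP[/eqP-> /eqP->]|ne] := boolP ((k == i) && (l == j)).
all: by rewrite ?UTE_entry ?UTE_entry0 ?zE //; have [] := zero k l kl ne.
Qed.

(** * Factorisation into elementary matrices *)

Definition clear_mx M i j : 'M[Zmax]_n :=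
  \matrix_(k, l) if (k == i) && (l == j) then 0 else M k l.

Lemma unitriangular_clear M i j : (i < j)%N -> unitriangular (clear_mx M i j).
Proof.
move=> ij; apply/unitriangularP; split=> [k|k l lk]; rewrite mxE.
  case: andP => [[/eqP ki /eqP kj]|_]; last exact: UT_diag.
  by move: ij; rewrite -ki -kj ltnn.
by case: ifP => // _; apply: UT_lower.
Qed.

Definition UTclear M i j (ij : (i < j)%N) : UT n :=
  MkUT (unitriangular_clear M ij).

(** Left multiplication by [E_ij(z)] adds [z] times row [j] to row [i]; when
    row [j] is that of the identity, only the entry [(i, j)] changes. *)
Lemma UTE_mul_clear M i j (ij : (i < j)%N) z :
  (forall l, j != l -> M j l = 0) -> M i j = Some z ->
  M = (UTE ij z * UTclear M ij)%g.
Proof.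
move=> rowj Mij; have nij : i != j by rewrite -val_eqE ltn_eqF.
apply: UT_eq => k l kl; rewrite UTmul_offdiag //.
rewrite big1 ?addr0 => [|m /andP[mk ml]]; last first.
  have [/andP[_ /eqP mj]|ne] := boolP ((k == i) && (m == j)).
    rewrite mj in ml *.
    by rewrite [X in _ * X]mxE eq_sym (negPf nij) rowj ?mulr0.
  by rewrite UTE_entry0 ?mul0r // eq_sym.
rewrite [X in _ + X]mxE.
have [/andP[/eqP-> /eqP->]|ne] := boolP ((k == i) && (l == j)).
  by rewrite UTE_entry addr0.
by rewrite UTE_entry0 // add0r.
Qed.

Definition offdiag_support M : pred ('I_n * 'I_n) :=
  [pred p | (p.1 != p.2) && (M p.1 p.2 != 0)].

Lemma offdiag_support_clear M i j (ij : (i < j)%N) :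
  M i j != 0 ->
  (#|offdiag_support (UTclear M ij)| < #|offdiag_support M|)%N.
Proof.
move=> Mij; apply: proper_card; apply/properP; split.
  apply/fintype.subsetP => -[k l]; rewrite !inE /= mxE => /andP[-> /=].
  by case: ifP => //; rewrite eqxx.
exists (i, j); rewrite !inE /=; first by rewrite Mij -val_eqE ltn_eqF.
by rewrite mxE !eqxx /= andbF.
Qed.

Lemma generating_elementary :
  generating ([set 1%g : UT n] `|` elementaryUT n).
Proof.
apply/seteqP; split=> // M _ H [subH XH].
have [m] := ubnP #|offdiag_support M|; elim: m M => // m IHm M; rewrite ltnS => le.
case: (pickP (offdiag_support M)) => [p0 p0M|M0]; last first.
  suff -> : M = 1%g by apply: XH; left.
  apply: UT_eq => i j ij; rewrite [RHS]mxE (negPf ij); apply/eqP.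
  by have /negbT := M0 (i, j); rewrite /offdiag_support /= ij negbK.
(* The row [i] is maximal, so that row [j > i] is that of the identity. *)
case: (arg_maxnP (fun p : 'I_n * 'I_n => p.1 : nat) p0M) => -[i j].
case/andP=> /= nij Mij maxi.
have ij : (i < j)%N.
  rewrite ltn_neqAle val_eqE nij leqNgt; apply/negP => ji.
  by rewrite UT_lower ?eqxx in Mij.
have rowj l : j != l -> M j l = 0.
  move=> jl; apply: contraTeq ij => Mjl; rewrite -leqNgt.
  by apply: (maxi (j, l)); rewrite /offdiag_support /= jl.
case Mz: (M i j) (Mij) => [z|] // _.
rewrite (UTE_mul_clear ij rowj Mz); apply: subH.
  by apply: XH; right; exists i, j, ij, z.
by apply: IHm; apply: leq_trans le; apply: offdiag_support_clear.
Qed.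

End Unitriangular.

Theorem corollary3p6 (n : nat) (hn : (0 < n)%N) :
  minimal_generating ([set 1%g : UT n] `|` elementaryUT n) /\
  irredundant_generating ([set 1%g : UT n] `|` elementaryUT n).
Proof.
apply: unavoidable_minimal_irredundant; first exact: generating_elementary.
move=> _ [->|[i [j [ij [z ->]]]]] A B; first exact: factor_UT1.
exact: factor_UTE.
Qed.
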